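(* Let $R$ be a cut-free $\mathsf{MLL}$ proof-structure and $\mathcal{L}$ a set of pairs of formula occurrences of $R$. Then $\{\pi|_\mathbf{J} \mid \pi\in\mathsf{seq}(\mathbf{J}_\mathcal{L}(R))\} = \mathsf{seq}_\mathcal{L}(R)$. Equivalently, applying $\mathbf{J}_\mathcal{L}(\cdot)$, then taking sequentializations, then erasing $\mathbf{J}$ (pointwise), coincides with $\mathsf{seq}_\mathcal{L}(\cdot)$.
   Context: $\mathsf{seq}(R)$ is the set of sequent proofs desequentializing to $R$, and $\mathsf{seq}_\mathcal{L}(R)=\{\pi\in\mathsf{seq}(R)\mid\forall(F,F')\in\mathcal{L}, F \text{ is above } F' \text{ in } \pi\}$. $F$ is above $F'$ when the rule creating $F$ lies on the same branch as, and above, the rule using $F'$. $\mathbf{J}$ is a special atom. The system $\mathsf{MLL}_\mathbf{J}$ is cut-free $\mathsf{MLL}$ (with tensor $\otimes$ and par ⅋) extended with the following rules. First, $\otimes_\mathbf{J}$ tensors a non-$J$ formula $F$ with $\mathbf{J}$ coming from a rule $\mathbf{J}(n)$. Second, ⅋$_{\mathbf{J}^\perp}$ derives $\vdash\Gamma,F⅋\mathbf{J}^\perp,\Theta_\mathbf{J}$ from $\vdash\Gamma,F,\mathbf{J}^\perp,\Theta_\mathbf{J}$. Third, the axioms $\mathbf{J}(m)$: $\vdash\mathbf{J},\mathbf{J}^\perp,\dots,\mathbf{J}^\perp$ with $m$ copies of $\mathbf{J}^\perp$. Fourth, the contractions $\mathbf{J}(n)$: from $\vdash\Gamma,\mathbf{J}^\perp,\dots,\mathbf{J}^\perp$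 ($n$ copies) derive $\vdash\Gamma,\mathbf{J}^\perp$. There are corresponding $\mathbf{J}$-axiom and $\mathbf{J}^\perp$-contraction links in proof-structures, and plain axioms on $J$-formulas are disallowed. $\mathbf{J}(R)$ replaces each edge $F$ of $R$ by the gadget $(F\otimes\mathbf{J})⅋\mathbf{J}^\perp$. Here $\mathbf{J}$ comes from a $\mathbf{J}$-axiom link (the $\otimes$ is the out-synchronisation point of $F$), and $\mathbf{J}^\perp$ is the conclusion of a $\mathbf{J}^\perp$-contraction link (the ⅋ is the in-synchronisation point of $F$). $\mathbf{J}_\mathcal{L}(R)$ is $\mathbf{J}(R)$ where, for each $(F,F')\in\mathcal{L}$, an extra $\mathbf{J}^\perp$ edge connects the $\mathbf{J}$-axiom link of $F$'s gadget to the $\mathbf{J}^\perp$-contraction link of $F'$'s gadget. $\pi|_\mathbf{J}$ denotes erasure of all $\mathbf{J}$-related formulas, links and rules, leaving an $\mathsf{MLL}$ proof.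
   Formalization: ''F is above F''' is sharpened: if F' is a premise of a tensor rule, the rule creating F must be in the subproof of the premise containing F'; and a conclusion F' of the proof, used by no rule, counts as used at the root. With the literal definition the equality fails. *)

(* Defs.v *)
From HB Require Import structures.
From mathcomp Require Import all_boot.

Set Implicit Arguments.
Unset Strict Implicit.
Unset Printing Implicit Defensive.

Inductive formula (At : Type) : Type :=
| Atom of At
| Coatom of At
| Tensor of formula At & formula At
| Parr of formula At & formula At.

Arguments Atom {At}.
Arguments Coatom {At}.

Fixpoint dual (At : Type) (f : formula At) : formula At :=
  match f with
  | Atom x => Coatom x
  | Coatom x => Atom x
  | Tensor f1 f2 => Parr (dual f1) (dual f2)
  | Parr f1 f2 => Tensor (dual f1) (dual f2)
  end.

(* The atoms of MLL_J are those of MLL, together with the special atom J,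
   represented by [None]. *)
Definition J {At : Type} : formula (option At) := Atom None.
Definition Jperp {At : Type} : formula (option At) := Coatom None.

Definition nonJ (At : Type) (f : formula (option At)) : Prop :=
  f <> J /\ f <> Jperp.

Fixpoint embed (At : Type) (f : formula At) : formula (option At) :=
  match f with
  | Atom x => Atom (Some x)
  | Coatom x => Coatom (Some x)
  | Tensor f1 f2 => Tensor (embed f1) (embed f2)
  | Parr f1 f2 => Parr (embed f1) (embed f2)
  end.

(* Links of proof-structures whose edges (formula occurrences) are named in E.
   [LTens a b c] and [LPar a b c] have premises a, b and conclusion c;
   [LJax j ks] is a J-axiom link with conclusions j (labelled J) and ks
   (labelled J^perp); [LJctr ks k] is a J^perp-contraction link. *)
Inductive link (E : Type) : Type :=
| LAx of E & E
| LTens of E & E & E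
| LPar of E & E & E
| LJax of E & seq E
| LJctr of seq E & E.

Definition premises (E : Type) (l : link E) : seq E :=
  match l with
  | LAx _ _ | LJax _ _ => [::]
  | LTens a b _ | LPar a b _ => [:: a; b]
  | LJctr ks _ => ks
  end.

Definition conclusions (E : Type) (l : link E) : seq E :=
  match l with
  | LAx a b => [:: a; b]
  | LTens _ _ c | LPar _ _ c => [:: c]
  | LJax j ks => j :: ks
  | LJctr _ k => [:: k]
  end.

Section LinkEqType.
Variable E : eqType.

Definition link_code (l : link E) : nat * (seq E * seq E) :=
  (match l with
   | LAx _ _ => 0 | LTens _ _ _ => 1 | LPar _ _ _ => 2
   | LJax _ _ => 3 | LJctr _ _ => 4
   end, (premises l, conclusions l)).

Definition link_decode (u : nat * (seq E * seq E)) : option (link E) :=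
  match u with
  | (0, (_, [:: a; b])) => Some (LAx a b)
  | (1, ([:: a; b], [:: c])) => Some (LTens a b c)
  | (2, ([:: a; b], [:: c])) => Some (LPar a b c)
  | (3, (_, j :: ks)) => Some (LJax j ks)
  | (4, (ks, [:: k])) => Some (LJctr ks k)
  | _ => None
  end.

Lemma link_codeK : pcancel link_code link_decode.
Proof. by case. Qed.

HB.instance Definition _ := Equality.copy (link E) (pcan_type link_codeK).
End LinkEqType.

Record pstruct (At E : Type) : Type := PStruct {
  label : E -> formula At;
  links : seq (link E)
}.

Definition edges (At : Type) (E : eqType) (R : pstruct At E) : seq E :=
  flatten [seq conclusions l | l <- links R].

Definition used_edges (At : Type) (E : eqType) (R : pstruct At E) : seq E :=
  flatten [seq premises l | l <- links R].

Definition ps_conclusions (At : Type) (E : eqType) (R : pstruct At E) : seq E :=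
  [seq e <- edges R | e \notin used_edges R].

Definition mll_typed (At E : Type) (lab : E -> formula At) (l : link E) : Prop :=
  match l with
  | LAx a b => lab b = dual (lab a)
  | LTens a b c => lab c = Tensor (lab a) (lab b)
  | LPar a b c => lab c = Parr (lab a) (lab b)
  | LJax _ _ | LJctr _ _ => False
  end.

(* There is no cut link, so all proof-structures are cut-free. *)
Definition mll_proof_structure (At : Type) (E : finType) (R : pstruct At E) :
    Prop :=
  [/\ forall l, l \in links R -> mll_typed (label R) l,
      forall e : E, e \in edges R,
      uniq (edges R)
    & uniq (used_edges R)].

(* Cut-free MLL sequent proofs. Sequents consist of formula occurrences named
   in E; each rule records the names of its active and principal occurrences,
   so that a proof desequentializes to a structure with the same edges. *)
Inductive proof (E : Type) : Type :=
| PAx of E & E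
| PTens of E & E & E & proof E & proof E
| PPar of E & E & E & proof E.

(* [derives lab p s]: p is a proof of the sequent s, where the occurrence x is
   an occurrence of the formula [lab x]. Exchange is implicit. *)
Inductive derives (At : Type) (E : eqType) (lab : E -> formula At) :
    proof E -> seq E -> Prop :=
| D_ax a b :
    lab b = dual (lab a) ->
    derives lab (PAx a b) [:: a; b]
| D_tens a b c p q s t :
    derives lab p (a :: s) -> derives lab q (b :: t) ->
    lab c = Tensor (lab a) (lab b) ->
    derives lab (PTens a b c p q) (c :: s ++ t)
| D_par a b c p s :
    derives lab p [:: a, b & s] ->
    lab c = Parr (lab a) (lab b) ->
    derives lab (PPar a b c p) (c :: s)
| D_exchange p s t :
    derives lab p s -> perm_eq s t -> derives lab p t.

Fixpoint deseq (E : Type) (p : proof E) : seq (link E) :=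
  match p with
  | PAx a b => [:: LAx a b]
  | PTens a b c p q => LTens a b c :: deseq p ++ deseq q
  | PPar a b c p => LPar a b c :: deseq p
  end.

Definition seqs (At : Type) (E : eqType) (R : pstruct At E) (p : proof E) :
    Prop :=
  derives (label R) p (ps_conclusions R) /\ perm_eq (deseq p) (links R).

Inductive subproof (E : Type) : proof E -> proof E -> Prop :=
| Sub_refl p : subproof p p
| Sub_tens_l r a b c p q : subproof r p -> subproof r (PTens a b c p q)
| Sub_tens_r r a b c p q : subproof r q -> subproof r (PTens a b c p q)
| Sub_par r a b c p : subproof r p -> subproof r (PPar a b c p).

Definition creates (E : Type) (r : proof E) (f : E) : Prop :=
  match r with
  | PAx a b => f = a \/ f = b
  | PTens _ _ c _ _ | PPar _ _ c _ => f = c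
  end.

(* The last rule of r uses f, which occurs in the end sequent of its immediate
   subproof q. *)
Definition uses (E : Type) (r : proof E) (f : E) (q : proof E) : Prop :=
  match r with
  | PAx _ _ => False
  | PTens a b _ p1 p2 => f = a /\ q = p1 \/ f = b /\ q = p2
  | PPar a b _ p1 => (f = a \/ f = b) /\ q = p1
  end.

(* q is the subproof of p standing immediately above the use of f; a conclusion
   of p, which no rule uses, counts as used at the root, below the whole of p. *)
Definition above_use (E : Type) (p : proof E) (f : E) (q : proof E) : Prop :=
  (exists2 r, subproof r p & uses r f q) \/
  q = p /\ ~ (exists r q', subproof r p /\ uses r f q').

(* The branches through the use of f' are those that go through f' itself: if
   f' is a premise of a tensor rule, the rule creating f has to be on the side
   of f' (a J^perp edge cannot join the two sides of a tensor rule). *)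
Definition above (E : Type) (p : proof E) (f f' : E) : Prop :=
  exists2 q, above_use p f' q & exists2 r, subproof r q & creates r f.

Definition seqs_constrained (At : Type) (E : finType) (L : {set E * E})
    (R : pstruct At E) (p : proof E) : Prop :=
  seqs R p /\ forall f f', (f, f') \in L -> above p f f'.

(* Sequent proofs of MLL_J. The right subproof of a [JTensJ] rule is required by
   [Jderives] to be an axiom J(m). *)
Inductive Jproof (N : Type) : Type :=
| JAx of N & N
| JTens of N & N & N & Jproof N & Jproof N
| JPar of N & N & N & Jproof N
| JTensJ of N & N & N & Jproof N & Jproof N
| JParJ of N & N & N & Jproof N
| JJax of N & seq N
| JJctr of seq N & N & Jproof N.

(* Contexts s, t may contain J-formulas, which accounts for Theta_J. *)
Inductive Jderives (At : Type) (N : eqType) (lab : N -> formula (option At)) :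
    Jproof N -> seq N -> Prop :=
| JD_ax a b :
    nonJ (lab a) -> lab b = dual (lab a) ->
    Jderives lab (JAx a b) [:: a; b]
| JD_tens a b c p q s t :
    Jderives lab p (a :: s) -> Jderives lab q (b :: t) ->
    nonJ (lab a) -> nonJ (lab b) -> lab c = Tensor (lab a) (lab b) ->
    Jderives lab (JTens a b c p q) (c :: s ++ t)
| JD_par a b c p s :
    Jderives lab p [:: a, b & s] ->
    nonJ (lab a) -> nonJ (lab b) -> lab c = Parr (lab a) (lab b) ->
    Jderives lab (JPar a b c p) (c :: s)
| JD_tensJ a j c p ks s t :
    Jderives lab p (a :: s) -> Jderives lab (JJax j ks) (j :: t) ->
    nonJ (lab a) -> lab c = Tensor (lab a) J ->
    Jderives lab (JTensJ a j c p (JJax j ks)) (c :: s ++ t)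
| JD_parJ a k c p s :
    Jderives lab p [:: a, k & s] ->
    nonJ (lab a) -> lab k = Jperp -> lab c = Parr (lab a) Jperp ->
    Jderives lab (JParJ a k c p) (c :: s)
| JD_Jax j ks :
    lab j = J -> (forall k, k \in ks -> lab k = Jperp) ->
    Jderives lab (JJax j ks) (j :: ks)
| JD_Jctr ks k p s :
    Jderives lab p (ks ++ s) ->
    (forall k', k' \in ks -> lab k' = Jperp) -> lab k = Jperp ->
    Jderives lab (JJctr ks k p) (k :: s)
| JD_exchange p s t :
    Jderives lab p s -> perm_eq s t -> Jderives lab p t.

Fixpoint Jdeseq (N : Type) (p : Jproof N) : seq (link N) :=
  match p with
  | JAx a b => [:: LAx a b]
  | JTens a b c p q | JTensJ a b c p q => LTens a b c :: Jdeseq p ++ Jdeseq q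
  | JPar a b c p | JParJ a b c p => LPar a b c :: Jdeseq p
  | JJax j ks => [:: LJax j ks]
  | JJctr ks k p => LJctr ks k :: Jdeseq p
  end.

Definition Jseqs (At : Type) (N : eqType) (S : pstruct (option At) N)
    (p : Jproof N) : Prop :=
  Jderives (label S) p (ps_conclusions S) /\ perm_eq (Jdeseq p) (links S).

(* Erasure of J. Since F, F * J and (F * J) | J^perp become the same formula, rho
   names the occurrence into which each occurrence collapses. Nothing remains of
   an axiom J(m). *)
Fixpoint erase (N E : Type) (rho : N -> E) (p : Jproof N) : option (proof E) :=
  match p with
  | JAx a b => Some (PAx (rho a) (rho b))
  | JTens a b c p q =>
      match erase rho p, erase rho q with
      | Some p', Some q' => Some (PTens (rho a) (rho b) (rho c) p' q')
      | _, _ => None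
      end
  | JPar a b c p => omap (PPar (rho a) (rho b) (rho c)) (erase rho p)
  | JTensJ _ _ _ p _ | JParJ _ _ _ p | JJctr _ _ p => erase rho p
  | JJax _ _ => None
  end.

(* Edges of J_L(R). In the gadget of the edge F of R, [Core F] is the edge F
   coming from R, [Jaxiom F] the edge J, [Sync F] the edge F * J, [Jcontr F] the
   edge J^perp below the contraction link and [Out F] the conclusion of the
   gadget. [Inner F] is a J^perp edge from the J-axiom link of F to the
   contraction link of F itself, and [Jump F F'] is the edge for (F, F') in L. *)
Inductive Jedge (E : Type) : Type :=
| Core of E
| Jaxiom of E
| Sync of E
| Jcontr of E
| Out of E
| Inner of E
| Jump of E & E.

Section JedgeEqType.
Variable E : eqType.

Definition Jedge_code (x : Jedge E) : nat * seq E :=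
  match x with
  | Core f => (0, [:: f]) | Jaxiom f => (1, [:: f]) | Sync f => (2, [:: f])
  | Jcontr f => (3, [:: f]) | Out f => (4, [:: f]) | Inner f => (5, [:: f])
  | Jump f f' => (6, [:: f; f'])
  end.

Definition Jedge_decode (u : nat * seq E) : option (Jedge E) :=
  match u with
  | (0, [:: f]) => Some (Core f) | (1, [:: f]) => Some (Jaxiom f)
  | (2, [:: f]) => Some (Sync f) | (3, [:: f]) => Some (Jcontr f)
  | (4, [:: f]) => Some (Out f) | (5, [:: f]) => Some (Inner f)
  | (6, [:: f; f']) => Some (Jump f f')
  | _ => None
  end.

Lemma Jedge_codeK : pcancel Jedge_code Jedge_decode.
Proof. by case. Qed.

HB.instance Definition _ := Equality.copy (Jedge E) (pcan_type Jedge_codeK).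
End JedgeEqType.

(* The values on edges labelled J or J^perp are irrelevant. *)
Definition origin (E : Type) (x : Jedge E) : E :=
  match x with
  | Core f | Jaxiom f | Sync f | Jcontr f | Out f | Inner f | Jump f _ => f
  end.

Definition gadget_formula (At : Type) (f : formula (option At)) :
    formula (option At) :=
  Parr (Tensor f J) Jperp.

(* The premises of the tensor or par link with conclusion e; [None] if e is the
   conclusion of an axiom link. *)
Definition operands (At : Type) (E : eqType) (R : pstruct At E) (e : E) :
    option (E * E) :=
  ohead (pmap (fun l => match l with
                        | LTens a b c | LPar a b c =>
                            if c == e then Some (a, b) else None
                        | _ => None
                        end) (links R)).

(* The label of [Core e], where f is the label of e in R. Axioms of R need not
   be atomic: the conclusions of an axiom link keep their label, even when it is
   a compound formula. *)
Fixpoint core_label (At : Type) (E : eqType) (R : pstruct At E)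
    (f : formula At) (e : E) {struct f} : formula (option At) :=
  match f, operands R e with
  | Tensor f1 f2, Some (a, b) =>
      Tensor (gadget_formula (core_label R f1 a))
             (gadget_formula (core_label R f2 b))
  | Parr f1 f2, Some (a, b) =>
      Parr (gadget_formula (core_label R f1 a))
           (gadget_formula (core_label R f2 b))
  | _, _ => embed f
  end.

Definition Jlabel (At : Type) (E : eqType) (R : pstruct At E) (x : Jedge E) :
    formula (option At) :=
  match x with
  | Core e => core_label R (label R e) e
  | Jaxiom _ => J
  | Sync e => Tensor (core_label R (label R e) e) J
  | Jcontr _ | Inner _ | Jump _ _ => Jperp
  | Out e => gadget_formula (core_label R (label R e) e)
  end.

Section JumpStructure.
Variables (At : Type) (E : finType).
(* Whether the gadget of F has its own J^perp edge [Inner F], joining its J-axiom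
   link to its contraction link, or only the edges given by L. *)
Variable inner : bool.
Variables (L : {set E * E}) (R : pstruct At E).

Definition Jlink (l : link E) : link (Jedge E) :=
  match l with
  | LAx a b => LAx (Core a) (Core b)
  | LTens a b c => LTens (Out a) (Out b) (Core c)
  | LPar a b c => LPar (Out a) (Out b) (Core c)
  | LJax j ks => LJax (Core j) (map (@Core E) ks)
  | LJctr ks k => LJctr (map (@Core E) ks) (Core k)
  end.

Definition inner_edge (e : E) : seq (Jedge E) :=
  if inner then [:: Inner e] else [::].

Definition jumps_from (e : E) : seq (Jedge E) :=
  inner_edge e ++ [seq Jump e e' | e' <- enum E & (e, e') \in L].

Definition jumps_to (e : E) : seq (Jedge E) :=
  inner_edge e ++ [seq Jump e' e | e' <- enum E & (e', e) \in L].

Definition gadget (e : E) : seq (link (Jedge E)) :=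
  [:: LJax (Jaxiom e) (jumps_from e);
      LTens (Core e) (Jaxiom e) (Sync e);
      LJctr (jumps_to e) (Jcontr e);
      LPar (Sync e) (Jcontr e) (Out e)].

(* J_L(R); J(R) is the case where L is empty. *)
Definition JL : pstruct (option At) (Jedge E) :=
  {| label := Jlabel R;
     links := [seq Jlink l | l <- links R] ++ flatten [seq gadget e | e <- enum E] |}.

End JumpStructure.

Definition mllJ_typed (At : Type) (N : eqType) (lab : N -> formula (option At))
    (l : link N) : Prop :=
  match l with
  | LAx a b => nonJ (lab a) /\ lab b = dual (lab a)
  | LTens a b c =>
      [/\ nonJ (lab a), nonJ (lab b) \/ lab b = J
        & lab c = Tensor (lab a) (lab b)]
  | LPar a b c =>
      [/\ nonJ (lab a), nonJ (lab b) \/ lab b = Jperp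
        & lab c = Parr (lab a) (lab b)]
  | LJax j ks => lab j = J /\ forall k, k \in ks -> lab k = Jperp
  | LJctr ks k => (forall k', k' \in ks -> lab k' = Jperp) /\ lab k = Jperp
  end.

Definition mllJ_proof_structure (At : Type) (N : eqType)
    (S : pstruct (option At) N) : Prop :=
  [/\ forall l, l \in links S -> mllJ_typed (label S) l,
      {subset used_edges S <= edges S},
      uniq (edges S)
    & uniq (used_edges S)].

Section JumpStructureCorrect.
Variables (At : Type) (E : finType) (inner : bool).
Variables (L : {set E * E}) (R : pstruct At E).
Hypothesis HR : mll_proof_structure R.

Lemma links_concl_inj l l' e : l \in links R -> l' \in links R ->
  e \in conclusions l -> e \in conclusions l' -> l = l'.
Proof.
case: HR => _ _; rewrite /edges => + _.
elim: (links R) => //= k ks IH; rewrite cat_uniq => /and3P[_ /hasPn Hk uks].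
rewrite !inE => /orP[/eqP->|lk] /orP[/eqP->|l'k] // el el'; last exact: IH.
  have /Hk : e \in flatten [seq conclusions x | x <- ks].
    by apply/flatten_mapP; exists l'.
  by rewrite /= el.
have /Hk : e \in flatten [seq conclusions x | x <- ks].
  by apply/flatten_mapP; exists l.
by rewrite /= el'.
Qed.

Lemma operandsE l e a b : l \in links R ->
  l = LTens a b e \/ l = LPar a b e -> operands R e = Some (a, b).
Proof.
move=> lR Hl; rewrite /operands; set F := (X in pmap X _).
have Fl : F l = Some (a, b) by case: Hl => ->; rewrite /F eqxx.
have el : e \in conclusions l by case: Hl => ->; rewrite inE.
have Fx x : x \in links R -> F x = None \/ F x = Some (a, b).
  move=> xR; case Ex: (F x) => [u|]; [right|by left].
  suff El : l = x by rewrite -Ex -El.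
  apply: (links_concl_inj lR xR el); move: Ex.
  by case: x {xR} => //= [a' b' c|a' b' c]; case: eqP => // -> _; rewrite inE.
elim: (links R) lR Fx => //= x s IH; rewrite inE => lxs Fx.
case: (Fx x); rewrite ?mem_head // => Ex; rewrite Ex //=.
apply: IH => [|y ys]; last by apply: Fx; rewrite inE ys orbT.
by case/orP: lxs => // /eqP lx; move: Ex; rewrite -lx Fl.
Qed.

Lemma nonJ_core e : nonJ (core_label R (label R e) e).
Proof.
by case: (label R e) => [x|x|f g|f g] /=; split=> //; case: operands => // -[].
Qed.

Lemma core_label_ax f e : operands R e = None -> core_label R f e = embed f.
Proof. by case: f => //= f g ->. Qed.

Lemma dual_embed (f : formula At) : dual (embed f) = embed (dual f).
Proof. by elim: f => //= f -> g ->. Qed.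

Lemma operands_ax a b e : LAx a b \in links R -> e \in [:: a; b] ->
  operands R e = None.
Proof.
move=> lR eab; rewrite /operands; set F := (X in pmap X _).
have Fx x : x \in links R -> F x = None.
  move=> xR; case Ex: (F x) => [u|] //.
  suff Ex' : LAx a b = x by rewrite -Ex' in Ex.
  apply: (links_concl_inj lR xR eab); move: Ex.
  by case: x {xR} => //= [a' b' c|a' b' c]; case: eqP => // -> _; rewrite inE.
elim: (links R) Fx => //= x s IH Fx; rewrite Fx ?mem_head //=.
by apply: IH => y ys; apply: Fx; rewrite inE ys orbT.
Qed.

Lemma uniq_blocks (T : eqType) (g : T -> E) (blk : E -> seq T) s :
  uniq s -> (forall e, uniq (blk e)) -> (forall e x, x \in blk e -> g x = e) ->
  uniq (flatten [seq blk e | e <- s]).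
Proof.
move=> us ub gb; elim: s us => //= e s IH /andP[es us].
rewrite cat_uniq ub IH // andbT; apply/hasPn => x /flatten_mapP[e' e's xe'].
by apply: contraNN es => /gb <-; rewrite (gb _ _ xe').
Qed.

Lemma uniq_jumps_from e : uniq (jumps_from inner L e).
Proof.
rewrite /jumps_from cat_uniq; apply/and3P; split.
- by rewrite /inner_edge; case: inner.
- by apply/hasPn=> x /mapP[y _ ->]; rewrite /inner_edge; case: inner.
- by rewrite map_inj_uniq => [|x y []//]; apply/filter_uniq/enum_uniq.
Qed.

Lemma uniq_jumps_to e : uniq (jumps_to inner L e).
Proof.
rewrite /jumps_to cat_uniq; apply/and3P; split.
- by rewrite /inner_edge; case: inner.
- by apply/hasPn=> x /mapP[y _ ->]; rewrite /inner_edge; case: inner.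
- by rewrite map_inj_uniq => [|x y []//]; apply/filter_uniq/enum_uniq.
Qed.

Lemma jumps_fromE e x : x \in jumps_from inner L e ->
  x = Inner e /\ inner \/ exists2 e', x = Jump e e' & (e, e') \in L.
Proof.
rewrite mem_cat /inner_edge => /orP[|/mapP[e']].
  by case: inner => //; rewrite inE => /eqP->; left.
by rewrite mem_filter => /andP[? _] ->; right; exists e'.
Qed.

Lemma jumps_toE e x : x \in jumps_to inner L e ->
  x = Inner e /\ inner \/ exists2 e', x = Jump e' e & (e', e) \in L.
Proof.
rewrite mem_cat /inner_edge => /orP[|/mapP[e']].
  by case: inner => //; rewrite inE => /eqP->; left.
by rewrite mem_filter => /andP[? _] ->; right; exists e'.
Qed.

Lemma Jl_conclusions l : l \in links R ->
  conclusions (Jlink l) = map (@Core E) (conclusions l).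
Proof. by case: l. Qed.

Lemma Jl_premises l : l \in links R ->
  premises (Jlink l) = map (@Out E) (premises l).
Proof. by case: HR => H _ _ _ /H; case: l. Qed.

Lemma edges_JL : edges (JL inner L R) =
  map (@Core E) (edges R) ++
  flatten [seq Jaxiom e :: jumps_from inner L e ++ [:: Sync e; Jcontr e; Out e]
          | e <- enum E].
Proof.
rewrite /edges /= map_cat flatten_cat; congr cat.
  rewrite map_flatten -!map_comp; congr flatten.
  by apply/eq_in_map => l /Jl_conclusions.
by elim: (enum E) => //= e s IH; rewrite -!catA /= IH.
Qed.

Lemma used_JL : used_edges (JL inner L R) =
  map (@Out E) (used_edges R) ++
  flatten [seq [:: Core e, Jaxiom e & jumps_to inner L e ++ [:: Sync e; Jcontr e]]
          | e <- enum E].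
Proof.
rewrite /used_edges /= map_cat flatten_cat; congr cat.
  rewrite map_flatten -!map_comp; congr flatten.
  by apply/eq_in_map => l /Jl_premises.
by elim: (enum E) => //= e s IH; rewrite -!catA /= IH.
Qed.

Lemma JL_proof_structure : mllJ_proof_structure (JL inner L R).
Proof.
have [Ht Hc Hu Hv] := HR.
split.
- move=> l; rewrite mem_cat => /orP[/mapP[l' l'R ->]|/flatten_mapP[e _]].
    have := Ht _ l'R; case: l' l'R => //= [a b|a b c|a b c] lR tl.
    + split; first exact: nonJ_core.
      rewrite !core_label_ax ?(operands_ax lR) ?inE ?eqxx ?orbT // tl.
      by rewrite dual_embed.
    + by rewrite tl /= (operandsE lR (or_introl erefl)); split=> //; left.
    + by rewrite tl /= (operandsE lR (or_intror erefl)); split=> //; left.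
  rewrite !inE => /or4P[] /eqP-> /=.
  + by split=> // k /jumps_fromE[[-> _]|[? ->]].
  + by split=> //; [exact: nonJ_core | right].
  + by split=> // k /jumps_toE[[-> _]|[? ->]].
  + by split=> //; right.
- move=> x; rewrite used_JL edges_JL !mem_cat => /orP[/mapP[e _ ->]|].
    apply/orP; right; apply/flatten_mapP; exists e; rewrite ?mem_enum //.
    by rewrite !inE mem_cat !inE eqxx !orbT.
  case/flatten_mapP=> e _; rewrite !inE mem_cat !inE => /or4P[].
  + by move/eqP->; rewrite map_f ?Hc.
  + move=> /eqP->; apply/orP; right; apply/flatten_mapP; exists e.
      by rewrite ?mem_enum.
    by rewrite inE eqxx.
  + case/jumps_toE=> [[-> Hi]|[e' -> Hl]]; apply/orP; right; apply/flatten_mapP.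
      exists e; rewrite ?mem_enum // inE !mem_cat /inner_edge Hi inE eqxx.
      by rewrite !orbT.
    exists e'; rewrite ?mem_enum // inE !mem_cat (map_f (Jump e')) ?orbT //.
    by rewrite mem_filter Hl mem_enum.
  + move=> H; apply/orP; right; apply/flatten_mapP; exists e; rewrite ?mem_enum //.
    by case/orP: H => /eqP->; rewrite !inE mem_cat !inE eqxx ?orbT.
- rewrite edges_JL cat_uniq map_inj_uniq ?Hu /=; last by move=> ? ? [].
  apply/andP; split.
    apply/hasPn => x /flatten_mapP[e _]; rewrite inE mem_cat !inE.
    move=> H; apply/negP => /mapP[f _ Ex]; move: H; rewrite Ex /=.
    by rewrite orbF => /jumps_fromE[[]|[]].
  apply: (uniq_blocks (g := @origin E)); first exact: enum_uniq.
    move=> e; have N x : (forall f, x <> Inner f) -> (forall f f', x <> Jump f f') ->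
        x \in jumps_from inner L e = false.
      by move=> h1 h2; apply/negP => /jumps_fromE[[/h1]|[? /h2]].
    move: (jumps_from _ _ _) N (uniq_jumps_from e) => s N us.
    by rewrite /= cat_uniq us /= ?inE !mem_cat !inE !N.
  move=> e x; rewrite inE mem_cat !inE.
  by case/or3P=> [/eqP->|/jumps_fromE[[->]|[? ->]]|/or3P[]/eqP->].
- rewrite used_JL cat_uniq map_inj_uniq ?Hv /=; last by move=> ? ? [].
  apply/andP; split.
    apply/hasPn => x /flatten_mapP[e _]; rewrite !inE mem_cat !inE.
    move=> H; apply/negP => /mapP[f _ Ex]; move: H; rewrite Ex /=.
    by rewrite orbF => /jumps_toE[[]|[]].
  pose g (x : Jedge E) := if x is Jump _ f then f else origin x.
  apply: (uniq_blocks (g := g)); first exact: enum_uniq.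
    move=> e; have N x : (forall f, x <> Inner f) -> (forall f f', x <> Jump f f') ->
        x \in jumps_to inner L e = false.
      by move=> h1 h2; apply/negP => /jumps_toE[[/h1]|[? /h2]].
    move: (jumps_to _ _ _) N (uniq_jumps_to e) => s N us.
    by rewrite /= cat_uniq us /= ?inE !mem_cat !inE !N.
  move=> e x; rewrite !inE mem_cat !inE.
  by case/or4P=> [/eqP->|/eqP->|/jumps_toE[[->]|[? ->]]|/orP[]/eqP->].
Qed.

End JumpStructureCorrect.

(* Main.v *)
(** A sequentialization of [J_L(R)] collapses onto a sequent proof of [R] rule
    by rule. A J^perp edge [Jump F F'] appears in the sequents only below the
    rule creating [F], and has to be contracted before [Out F'] is available,
    hence above the use of [F']: this gives the constraint [L]. Conversely, in a
    proof satisfying [L], the out-synchronisation point of [F] is inserted right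
    below the rule creating [F], and its in-synchronisation point right above
    the use of [F] (or at the root); the constraint says exactly that all the
    J^perp edges to be contracted there are available. *)
Require Import Defs.
From HB Require Import structures.
From mathcomp Require Import all_boot zify.

Set Implicit Arguments.
Unset Strict Implicit.
Unset Printing Implicit Defensive.

(** * Occurrences created and used in an MLL proof *)

Section ProofEdges.
Variable E : eqType.
Implicit Types (p q r : proof E) (f : E).

(** Both lists are read off [deseq], so that for a sequentialization of [R] they are permutations of
    [edges R] and [used_edges R]. *)
Definition created p : seq E := flatten [seq conclusions l | l <- deseq p].
Definition used p : seq E := flatten [seq premises l | l <- deseq p].

Lemma created_tens a b c p q :
  created (PTens a b c p q) = c :: created p ++ created q.
Proof. by rewrite /created /= map_cat flatten_cat. Qed.

Lemma used_tens a b c p q :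
  used (PTens a b c p q) = [:: a, b & used p ++ used q].
Proof. by rewrite /used /= map_cat flatten_cat. Qed.

(** With [usedP], this trades the existential conditions inside [above] for boolean membership, on
    which one can argue by cases. *)
Lemma createdP p f :
  (exists2 r, subproof r p & creates r f) <-> f \in created p.
Proof.
split=> [[r]|].
  elim=> [{r p}[a b|a b c p q|a b c p] /=|||] => [[]->|->|->|||];
    rewrite ?inE ?eqxx ?orbT // => {r p}.
  - by move=> r a b c p q _ IH /IH; rewrite created_tens inE mem_cat => ->;
      rewrite orbT.
  - by move=> r a b c p q _ IH /IH; rewrite created_tens inE mem_cat => ->;
      rewrite !orbT.
  - by move=> r a b c p _ IH /IH; rewrite inE => ->; rewrite orbT.
elim: p => [a b|a b c p IHp q IHq|a b c p IHp].
- rewrite !inE => H; exists (PAx a b); first exact: Sub_refl.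
  by case/orP: H => /eqP->; [left|right].
- rewrite created_tens inE mem_cat => /or3P[/eqP->|/IHp[r]|/IHq[r]].
  + by exists (PTens a b c p q) => //; exact: Sub_refl.
  + by exists r => //; exact: Sub_tens_l.
  + by exists r => //; exact: Sub_tens_r.
- rewrite inE => /predU1P[->|/IHp[r]].
  + by exists (PPar a b c p) => //; exact: Sub_refl.
  + by exists r => //; exact: Sub_par.
Qed.

Lemma usedP p f :
  (exists r q, subproof r p /\ uses r f q) <-> f \in used p.
Proof.
split=> [[r [q []]]|].
  elim=> [{r p}[a b|a b c p p'|a b c p] /=|||] => [//|[[->]|[->]]|[[]->]|||];
    rewrite ?used_tens ?inE ?eqxx ?orbT // => {r p}.
  - by move=> r a b c p p' _ IH /IH H; rewrite used_tens !inE mem_cat H !orbT.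
  - by move=> r a b c p p' _ IH /IH H; rewrite used_tens !inE mem_cat H !orbT.
  - by move=> r a b c p _ IH /IH H; rewrite !inE H !orbT.
elim: p => [a b //|a b c p IHp q IHq|a b c p IHp].
- rewrite used_tens !inE mem_cat => /or4P[/eqP->|/eqP->|H|H].
  + by exists (PTens a b c p q), p; split; [exact: Sub_refl|left].
  + by exists (PTens a b c p q), q; split; [exact: Sub_refl|right].
  + by have [r [q' [? ?]]] := IHp H; exists r, q'; split=> //; exact: Sub_tens_l.
  + by have [r [q' [? ?]]] := IHq H; exists r, q'; split=> //; exact: Sub_tens_r.
- rewrite !inE => /or3P[/eqP->|/eqP->|H].
  + by exists (PPar a b c p), p; split; [exact: Sub_refl|split=> //; left].
  + by exists (PPar a b c p), p; split; [exact: Sub_refl|split=> //; right].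
  + by have [r [q' [? ?]]] := IHp H; exists r, q'; split=> //; exact: Sub_par.
Qed.

Lemma subproof_uses_trans r q f p : subproof r p -> uses r f q -> subproof q p.
Proof.
elim=> {r p} [[a b|a b c p p'|a b c p] //=|r a b c p p' _ IH|r a b c p p' _ IH
             |r a b c p _ IH].
- by case=> [[_ ->]|[_ ->]]; [apply: Sub_tens_l|apply: Sub_tens_r]; exact: Sub_refl.
- by case=> _ ->; apply: Sub_par; exact: Sub_refl.
- by move/IH; exact: Sub_tens_l.
- by move/IH; exact: Sub_tens_r.
- by move/IH; exact: Sub_par.
Qed.

Lemma subproof_trans r q p : subproof r q -> subproof q p -> subproof r p.
Proof.
move=> rq qp; elim: qp rq => // {q p} [q a b c p p' _ IH|q a b c p p' _ IH
  |q a b c p _ IH] /IH; [exact: Sub_tens_l|exact: Sub_tens_r|exact: Sub_par].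
Qed.

Lemma subproof_created r p : subproof r p -> {subset created r <= created p}.
Proof.
move=> rp f /createdP[r' r'r r'f]; apply/createdP; exists r' => //.
exact: subproof_trans rp.
Qed.

(** Every use of [f] contributes an entry to [used p], so uses at two different places would produce
    a duplicate. *)
Lemma use_unique p f r q r' q' : uniq (used p) ->
  subproof r p -> uses r f q -> subproof r' p -> uses r' f q' -> q = q'.
Proof.
move=> + rp; elim: rp r' q' => {r p} [p|r a b c p1 p2 rp IH|r a b c p1 p2 rp IH
   |r a b c p1 rp IH] r' q' up rq r'p.
- case: r'p rq up => {p r'} [p|r' a b c p1 p2 rp|r' a b c p1 p2 rp|r' a b c p1 rp].
  + case: p => [//|a b c p1 p2|a b c p1]; last by case=> _ -> _ [_ ->].
    rewrite used_tens /= !inE => H /andP[ab _] H'; move: ab.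
    by case: H => -[? ->]; case: H' => -[? ->] //; subst; rewrite eqxx.
  + move=> H + rq'; have fu : f \in used p1 by apply/usedP; exists r', q'.
    rewrite used_tens /= !inE !mem_cat.
    by case: H => -[<- _]; rewrite fu ?orbT ?andbF.
  + move=> H + rq'; have fu : f \in used p2 by apply/usedP; exists r', q'.
    rewrite used_tens /= !inE !mem_cat.
    by case: H => -[<- _]; rewrite fu ?orbT ?andbF.
  + move=> H + rq'; have fu : f \in used p1 by apply/usedP; exists r', q'.
    rewrite /used /= !inE.
    by case: H => -[] <- _; rewrite fu ?orbT ?andbF.
- have fu : f \in used p1 by apply/usedP; exists r, q.
  move: up; rewrite used_tens /= inE !mem_cat cat_uniq.
  case/and4P=> ap bp u1 /andP[dj u2] r'q'.
  inversion r'p; subst.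
  + case: r'q' => -[E1 _]; subst; first by rewrite fu orbT in ap.
    by rewrite fu in bp.
  + exact: IH r'q'.
  (* Uses on the two sides of a tensor put [f] in both of the disjoint halves of [used]. *)
  + have fu2 : f \in used p2 by apply/usedP; exists r', q'.
    by case/hasP: dj; exists f.
- have fu : f \in used p2 by apply/usedP; exists r, q.
  move: up; rewrite used_tens /= inE !mem_cat cat_uniq.
  case/and4P=> ap bp u1 /andP[dj u2] r'q'.
  inversion r'p; subst.
  + case: r'q' => -[E1 _]; subst; first by rewrite fu !orbT in ap.
    by rewrite fu orbT in bp.
  + have fu1 : f \in used p1 by apply/usedP; exists r', q'.
    by case/hasP: dj; exists f.
  + exact: IH r'q'.
- have fu : f \in used p1 by apply/usedP; exists r, q.
  move: up; rewrite /used /= inE; case/and3P=> ap bp u1 r'q'.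
  inversion r'p; subst.
  + case: r'q' => -[] E1 _; subst; first by rewrite fu orbT in ap.
    by rewrite fu in bp.
  + exact: IH r'q'.
Qed.

(** A rule consumes only occurrences from the sequents of its premises, and these are created there
    by induction. *)
Lemma derives_created At (lab : E -> formula At) p s :
  derives lab p s -> {subset s ++ used p <= created p}.
Proof.
elim=> {p s} [a b _|a b c p q s t _ IHp _ IHq _|a b c p s _ IH _|p s t _ IH st] x.
- by rewrite cats0.
- rewrite used_tens created_tens; move: (IHp x) (IHq x).
  rewrite !(inE, mem_cat) => + + H; move: H.
  by do ![case: (_ == _) => //=|case: (_ \in _) => //=]=> *; auto.
- move: (IH x); rewrite /used /created /= !(inE, mem_cat, cat_cons).
  by do ![case: (_ == _) => //=|case: (_ \in _) => //=]=> *; auto.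
- by rewrite mem_cat -(perm_mem st) -mem_cat; exact: IH.
Qed.

End ProofEdges.

(** * The constraint [L] as a condition on each use *)

Section Constraint.
Variables (E : finType) (L : {set E * E}).
Implicit Types (p q r : proof E) (f e : E).

Definition constrained p : Prop := forall r q f f',
  subproof r p -> uses r f' q -> (f, f') \in L -> f \in created q.

Lemma constrained_sub r p : subproof r p -> constrained p -> constrained r.
Proof.
by move=> rp Cp r' q f f' r'r; apply: Cp; exact: subproof_trans rp.
Qed.

Lemma constrained_used p f f' : constrained p ->
  (f, f') \in L -> f' \in used p -> f \in created p.
Proof.
move=> Cp fL /usedP[r [q [rp rq]]].
exact: (subproof_created (subproof_uses_trans rp rq)) (Cp _ _ _ _ rp rq fL).
Qed.

(** [above] only provides some use of [f']; uniqueness of uses identifies it with the given one. *)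
Lemma above_constrained p : uniq (used p) ->
  (forall f f', (f, f') \in L -> above p f f') -> constrained p.
Proof.
move=> up Ap r q f f' rp rq /Ap[q' + /createdP fq'].
case=> [[r' r'p r'q']|[_ []]]; last by exists r, q.
by rewrite (use_unique up rp rq r'p r'q').
Qed.

Lemma constrained_above p f f' : constrained p -> f \in created p ->
  (f, f') \in L -> above p f f'.
Proof.
move=> Cp fp fL; case: (boolP (f' \in used p)) => [/usedP[r [q [rp rq]]]|nu].
  by exists q; [left; exists r | apply/createdP; exact: Cp rq fL].
exists p; last exact/createdP.
by right; split=> // /usedP; exact/negP.
Qed.

End Constraint.

Lemma Jderives_Jax At (N : eqType) (lab : N -> formula (option At)) j ks s :
  Jderives lab (JJax j ks) s -> perm_eq (j :: ks) s /\ lab j = J.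
Proof.
move Eq: (JJax j ks) => q D; elim: D Eq => //.
- by move=> j' ks' Hj _ [-> ->].
- by move=> q' s' t' _ IH st /IH[H ?]; split=> //; exact: perm_trans st.
Qed.

(** * From sequentializations of J_L(R) to constrained proofs of [R] *)

Section Collapse.
Variables (At : Type) (E : finType) (inner : bool).
Variables (L : {set E * E}) (R : pstruct At E).
Hypothesis HR : mll_proof_structure R.
Local Notation S := (JL inner L R).

(** Inverting this predicate on the link of a J-rule tells whether the rule comes from a link of [R]
    or from a gadget, and exposes the constructors of its edges. *)
Variant JL_link : link (Jedge E) -> Prop :=
| JL_ax a b of LAx a b \in links R : JL_link (LAx (Core a) (Core b))
| JL_tens a b c of LTens a b c \in links R :
    JL_link (LTens (Out a) (Out b) (Core c))
| JL_par a b c of LPar a b c \in links R :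
    JL_link (LPar (Out a) (Out b) (Core c))
| JL_Jax e : JL_link (LJax (Jaxiom e) (jumps_from inner L e))
| JL_sync e : JL_link (LTens (Core e) (Jaxiom e) (Sync e))
| JL_Jctr e : JL_link (LJctr (jumps_to inner L e) (Jcontr e))
| JL_out e : JL_link (LPar (Sync e) (Jcontr e) (Out e)).

Lemma JL_linkP l : l \in links S -> JL_link l.
Proof.
rewrite mem_cat => /orP[/mapP[l' l'R ->]|/flatten_mapP[e _]].
  by case: HR => /(_ _ l'R) + _ _ _; case: l' l'R => //= *; constructor.
by rewrite !inE => /or4P[]/eqP->; constructor.
Qed.

Definition unJlink (l : link (Jedge E)) : option (link E) :=
  match l with
  | LAx (Core a) (Core b) => Some (LAx a b)
  | LTens (Out a) (Out b) (Core c) => Some (LTens a b c)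
  | LPar (Out a) (Out b) (Core c) => Some (LPar a b c)
  | _ => None
  end.

Lemma pmap_unJlink : pmap unJlink (links S) = links R.
Proof.
rewrite pmap_cat [X in _ ++ X](_ : _ = [::]) ?cats0; last first.
  by elim: (enum E) => //= e s IH.
case: HR => + _ _ _; elim: (links R) => //= l s IH Hl.
rewrite IH => [|l' l's]; last by apply: Hl; rewrite inE l's orbT.
by have := Hl l (mem_head _ _); case: l {Hl}.
Qed.

Definition nonJ_edge (x : Jedge E) : bool :=
  match x with Core _ | Sync _ | Out _ => true | _ => false end.

Definition collapse (s : seq (Jedge E)) : seq E :=
  [seq origin x | x <- s & nonJ_edge x].

Lemma collapse_cons x s :
  collapse (x :: s) = if nonJ_edge x then origin x :: collapse s else collapse s.
Proof. by rewrite /collapse /=; case: nonJ_edge. Qed.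

Lemma collapse_cat s t : collapse (s ++ t) = collapse s ++ collapse t.
Proof. by rewrite /collapse filter_cat map_cat. Qed.

Lemma collapse_J s : (forall x, x \in s -> Jlabel R x = Jperp) -> collapse s = [::].
Proof.
rewrite /collapse; elim: s => //= x s IH H.
rewrite -IH => [|y ys]; last by apply: H; rewrite inE ys orbT.
have [_ nJ] := nonJ_core R (origin x).
by have := H x (mem_head _ _); case: x {H} nJ => // e /=.
Qed.

(* An occurrence x in a sequent witnesses that f has been created above. *)
Definition requires (x : Jedge E) (f : E) : Prop :=
  match x with
  | Core e | Jump e _ => f = e
  | Jcontr e | Out e => (f, e) \in L
  | _ => False
  end.

(** The invariant of the induction on J-proofs. The third clause carries the information transmitted
    by the jumps downwards; where [Out e] is used, it yields the fourth. *)
Definition collapses_to (q : Jproof (Jedge E)) (s : seq (Jedge E)) (p : proof E) :=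
  [/\ derives (label R) p (collapse s),
      deseq p = pmap unJlink (Jdeseq q),
      forall x f, x \in s -> requires x f -> f \in created p
    & constrained L p].

Lemma erase_collapses q s p : Jderives (label S) q s ->
  {subset Jdeseq q <= links S} -> erase (@origin E) q = Some p ->
  collapses_to q s p.
Proof.
have [Ht _ _ _] := HR.
move=> D; elim: D p => {q s}.
- move=> a b nJ _ p sub [<-].
  have /JL_linkP H := sub _ (mem_head _ _).
  inversion H as [a' b' lR| | | | | |]; subst => {H}.
  split=> //; first by apply: D_ax; exact: Ht lR.
    by move=> x f; rewrite !inE => /orP[]/eqP-> ->; rewrite eqxx ?orbT.
  by move=> r q f f' rp; inversion rp; subst.
- move=> a b c q1 q2 s t _ IH1 _ IH2 nJa nJb _ p sub /=.
  have /JL_linkP H := sub _ (mem_head _ _).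
  have sub1 : {subset Jdeseq q1 <= links S}.
    by move=> x xq; apply: sub; rewrite inE mem_cat xq orbT.
  have sub2 : {subset Jdeseq q2 <= links S}.
    by move=> x xq; apply: sub; rewrite inE mem_cat xq !orbT.
  case E1: (erase _ q1) => [p1|] //; case E2: (erase _ q2) => [p2|] // -[<-].
  have {IH1}[D1 d1 r1 C1] := IH1 _ sub1 E1.
  have {IH2}[D2 d2 r2 C2] := IH2 _ sub2 E2.
  (* An out-synchronisation point is excluded, as its second premise is labelled J. *)
  inversion H as [|a' b' c' lR| | |e| |]; subst; last by case: nJb.
  rewrite !collapse_cons /= in D1 D2.
  split.
  + rewrite collapse_cons /= collapse_cat.
    by apply: (D_tens D1 D2); exact: Ht lR.
  + by rewrite /= pmap_cat d1 d2.
  + move=> x f; rewrite created_tens !inE !mem_cat.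
    case/or3P=> [/eqP->/= ->|xs xf|xt xf]; first by rewrite eqxx.
      by rewrite (r1 x) ?orbT // inE xs orbT.
    by rewrite (r2 x) ?orbT // inE xt orbT.
  + move=> r q f f' rp; inversion rp; subst => //=.
    (* [Out a'] is in the sequent of [p1], so what it requires is created on that side of the
       tensor; likewise for [Out b'] and [p2]. *)
    * by case=> -[-> ->] fL; [apply: (r1 (Out a'))|apply: (r2 (Out b'))];
        rewrite ?mem_head.
    * exact: C1.
    * exact: C2.
- move=> a b c q1 s _ IH1 nJa nJb _ p sub /=.
  have /JL_linkP H := sub _ (mem_head _ _).
  have sub1 : {subset Jdeseq q1 <= links S}.
    by move=> x xq; apply: sub; rewrite inE xq orbT.
  case E1: (erase _ q1) => [p1|] //= -[<-].
  have {IH1}[D1 d1 r1 C1] := IH1 _ sub1 E1.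
  inversion H as [| |a' b' c' lR| | | |e]; subst; last by case: nJb.
  rewrite !collapse_cons /= in D1.
  split.
  + rewrite collapse_cons /=.
    by apply: (D_par D1); exact: Ht lR.
  + by rewrite /= d1.
  + move=> x f; rewrite !inE.
    case/predU1P=> [->/= ->|xs xf]; first by rewrite eqxx.
    by apply/orP; right; apply: (r1 x) => //; rewrite !inE xs !orbT.
  + move=> r q f f' rp; inversion rp; subst => //=.
    * by case=> -[] -> -> fL; [apply: (r1 (Out a'))|apply: (r1 (Out b'))];
        rewrite // !inE eqxx ?orbT.
    * exact: C1.
- move=> a j c q1 ks s t _ IH1 DJ _ nJa _ p sub /= E1.
  have /JL_linkP H := sub _ (mem_head _ _).
  have sub1 : {subset Jdeseq q1 <= links S}.
    by move=> x xq; apply: sub; rewrite inE mem_cat xq orbT.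
  have /JL_linkP H2 : LJax j ks \in links S.
    by apply: sub; rewrite !inE mem_cat mem_head !orbT.
  have {IH1}[D1 d1 r1 C1] := IH1 _ sub1 E1.
  have [pk Jj] := Jderives_Jax DJ.
  (* The right premise is the J-axiom link of some [e'], which forces the tensor to be the
     out-synchronisation point of [e']. *)
  inversion H2 as [| | |e'| | |]; subst.
  inversion H as [| | | |e| |]; subst.
  rewrite !collapse_cons /= in D1.
  rewrite perm_cons in pk.
  split=> //.
  + rewrite collapse_cons /= collapse_cat (@collapse_J t) ?cats0 //.
    by move=> x; rewrite -(perm_mem pk) => /jumps_fromE[[->]|[? ->]].
  + by rewrite /= pmap_cat d1 cats0.
  + move=> x f; rewrite inE mem_cat => /or3P[/eqP-> //|xs|].
      by apply: r1; rewrite inE xs orbT.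
    (* A jump leaving [e'] requires [e'] itself, already witnessed by [Core e'] in the left
       premise. *)
    rewrite -(perm_mem pk) => /jumps_fromE[[->]|[? -> _]] //= ->.
    by apply: (r1 (Core e')) => //; exact: mem_head.
- move=> a k c q1 s _ IH1 nJa Jk _ p sub /= E1.
  have /JL_linkP H := sub _ (mem_head _ _).
  have sub1 : {subset Jdeseq q1 <= links S}.
    by move=> x xq; apply: sub; rewrite inE xq orbT.
  have {IH1}[D1 d1 r1 C1] := IH1 _ sub1 E1.
  inversion H as [| | | | | |e]; subst => //.
  split=> //.
  move=> x f; rewrite inE => /predU1P[-> /= fL|xs].
    by apply: (r1 (Jcontr e)) => //; rewrite !inE eqxx orbT.
  by apply: r1; rewrite !inE xs !orbT.
- by [].
- move=> ks k q1 s _ IH1 Jks Jk p sub /= E1.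
  have /JL_linkP H := sub _ (mem_head _ _).
  have sub1 : {subset Jdeseq q1 <= links S}.
    by move=> x xq; apply: sub; rewrite inE xq orbT.
  have {IH1}[D1 d1 r1 C1] := IH1 _ sub1 E1.
  inversion H as [| | | | |e|]; subst.
  rewrite collapse_cat (collapse_J Jks) /= in D1.
  split=> //.
  move=> x f; rewrite inE => /predU1P[-> /= fL|xs].
    (* For each [f] with [(f, e)] in [L], [Jump f e] is among the contracted occurrences, and it
       requires [f]. *)
    apply: (r1 (Jump f e)) => //; rewrite !mem_cat (map_f (fun e0 => Jump e0 e)) ?orbT //.
    by rewrite mem_filter fL mem_enum.
  by apply: r1; rewrite !mem_cat xs !orbT.
- move=> q s t _ IH st p sub Ep; have [D d r C] := IH p sub Ep.
  split=> //; last by move=> x f; rewrite -(perm_mem st); exact: r.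
  by apply: D_exchange D _; apply/perm_map/perm_filter.
Qed.

(** Every gadget edge other than [Out e] is a premise inside some gadget, and [Out e] is a premise
    exactly when [e] is one in [R]. *)
Lemma ps_conclusions_JL :
  perm_eq (ps_conclusions S) [seq Out e | e <- ps_conclusions R].
Proof.
have [_ Hc Hu _] := HR; have [_ _ uS _] := JL_proof_structure inner L HR.
apply: uniq_perm; first exact: filter_uniq.
  by rewrite map_inj_uniq ?filter_uniq // => ? ? [].
have usedg e x : x \in [:: Core e, Jaxiom e & jumps_to inner L e ++
    [:: Sync e; Jcontr e]] -> x \in used_edges S.
  move=> H; rewrite used_JL // mem_cat; apply/orP; right.
  by apply/flatten_mapP; exists e; rewrite ?mem_enum.
have Out_used e : Out e \in used_edges S = (e \in used_edges R).
  rewrite used_JL // mem_cat mem_map => [|? ? [] //].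
  case: (_ \in _) => //=; apply/negP => /flatten_mapP[e' _].
  rewrite !inE mem_cat => /orP[|] //=; rewrite !inE orbF.
  by case/jumps_toE => [[]|[]].
move=> x; rewrite mem_filter; apply/andP/mapP => [[nu]|[e + ->]].
  rewrite edges_JL // mem_cat => /orP[/mapP[e _ Ex]|/flatten_mapP[e _]].
    by rewrite Ex (usedg e) ?mem_head in nu.
  rewrite inE mem_cat !inE => /or3P[/eqP Ex|/jumps_fromE|/or3P[]/eqP Ex].
  - by rewrite Ex (usedg e) // !inE eqxx ?orbT in nu.
  - case=> [[Ex Hi]|[e' Ex Hl]].
      rewrite Ex (usedg e) // !inE !mem_cat /inner_edge Hi mem_head ?orbT // in nu.
    (* A jump is consumed in the gadget of its target [e'], not in that of its source. *)
    rewrite Ex (usedg e') // in nu; rewrite !inE !mem_cat (map_f (fun e0 => Jump e0 e')) ?orbT //.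
    by rewrite mem_filter Hl mem_enum.
  - by rewrite Ex (usedg e) // !(inE, mem_cat) eqxx ?orbT in nu.
  - by rewrite Ex (usedg e) // !(inE, mem_cat) eqxx ?orbT in nu.
  - by exists e => //; rewrite mem_filter Hc andbT -Out_used -Ex.
rewrite mem_filter => /andP[nu _]; rewrite Out_used; split=> //.
rewrite edges_JL // mem_cat; apply/orP; right; apply/flatten_mapP; exists e.
  by rewrite mem_enum.
by rewrite !(inE, mem_cat) eqxx !orbT.
Qed.

Lemma Jseqs_erase q p : Jseqs S q -> erase (@origin E) q = Some p ->
  seqs_constrained L R p.
Proof.
move=> [D dq] Ep; have [_ Hc _ _] := HR.
have sub : {subset Jdeseq q <= links S} by move=> x; rewrite (perm_mem dq).
have [Dp dp _ Cp] := erase_collapses D sub Ep.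
have pl : perm_eq (deseq p) (links R) by rewrite dp -pmap_unJlink perm_pmap.
split; first split=> //.
  apply: D_exchange Dp _; apply: perm_trans (perm_map _ (perm_filter _ ps_conclusions_JL)) _.
  by elim: (ps_conclusions R) => //= e s; rewrite perm_cons.
move=> f f'; apply: constrained_above => //.
(* Every [f] is an edge of [R], hence created in [p]; this covers the pairs whose [f'] is a
   conclusion. *)
by rewrite (perm_mem (perm_flatten (perm_map (@conclusions E) pl))); exact: Hc.
Qed.

End Collapse.

(** * Inserting the gadgets into a constrained proof of [R] *)

Section Expand.
Variables (At : Type) (E : finType) (inner : bool).
Variables (L : {set E * E}) (R : pstruct At E).
Hypothesis HR : mll_proof_structure R.
Local Notation S := (JL inner L R).
Implicit Types (p : proof E) (q : Jproof (Jedge E)) (A U : seq E) (e f : E).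

Definition sync_out e q : Jproof (Jedge E) :=
  JTensJ (Core e) (Jaxiom e) (Sync e) q (JJax (Jaxiom e) (jumps_from inner L e)).

Definition sync_in e q : Jproof (Jedge E) :=
  JParJ (Sync e) (Jcontr e) (Out e) (JJctr (jumps_to inner L e) (Jcontr e) q).

(** The conclusions of [expand p] stay at the stage [Sync]: each gadget is closed only at the use of
    its occurrence, or later at the root. *)
Fixpoint expand p : Jproof (Jedge E) :=
  match p with
  | PAx a b => sync_out b (sync_out a (JAx (Core a) (Core b)))
  | PTens a b c p1 p2 =>
      sync_out c (JTens (Out a) (Out b) (Core c)
                    (sync_in a (expand p1)) (sync_in b (expand p2)))
  | PPar a b c p1 =>
      sync_out c (JPar (Out a) (Out b) (Core c) (sync_in b (sync_in a (expand p1))))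
  end.

Lemma erase_expand p : erase (@origin E) (expand p) = Some p.
Proof. by elim: p => //= [a b c p -> q ->|a b c p ->]. Qed.

Definition target (x : Jedge E) : E := if x is Jump _ e then e else origin x.

(* The J^perp edges left in the sequent once the gadgets of A have been opened
   and those of U closed. *)
Definition pending A U : seq (Jedge E) :=
  [seq x <- flatten [seq jumps_from inner L e | e <- A] | target x \notin U].

Lemma eq_pending A U V :
  (forall e x, e \in A -> x \in jumps_from inner L e ->
     (target x \in U) = (target x \in V)) -> pending A U = pending A V.
Proof.
move=> UV; apply: eq_in_filter => x /flatten_mapP[e eA xe].
by rewrite (UV e).
Qed.

Lemma pending_cat A B U : pending (A ++ B) U = pending A U ++ pending B U.
Proof. by rewrite /pending map_cat flatten_cat filter_cat. Qed.

Lemma pending_cons e A U :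
  (forall x, x \in jumps_from inner L e -> target x \notin U) ->
  pending (e :: A) U = jumps_from inner L e ++ pending A U.
Proof.
by move=> H; rewrite /pending /= filter_cat; congr cat; apply/all_filterP/allP.
Qed.

(** All sources of edges into the contraction link of [e] are in [A], and none of these edges has
    been discarded since [e \notin U]; so exactly [jumps_to inner L e] can be contracted. *)
Lemma pending_close e A U : uniq A -> e \in A -> e \notin U ->
  (forall f, (f, e) \in L -> f \in A) ->
  perm_eq (pending A U) (jumps_to inner L e ++ pending A (e :: U)).
Proof.
move=> uA eA eU LA; set fl := flatten [seq jumps_from inner L e | e <- A].
have -> : pending A (e :: U) = [seq x <- pending A U | predC (fun x => target x == e) x].
  by rewrite -filter_predI; apply: eq_filter => x /=; rewrite inE negb_or.
(* Split the pending edges by whether their target is [e]; the first half must be recognised as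
   [jumps_to inner L e]. *)
rewrite -(perm_filterC (fun x => target x == e) (pending A U)) perm_cat2r perm_sym.
have ufl : uniq fl.
  apply: (uniq_blocks (g := @origin E)) => // [e'|e' x].
    exact: uniq_jumps_from.
  by case/jumps_fromE=> [[->]|[? ->]].
apply: uniq_perm; [exact: uniq_jumps_to|by do 2!apply: filter_uniq|].
move=> x; rewrite !mem_filter; apply/idP/and3P.
  case/jumps_toE=> [[-> Hi]|[e' -> Hl]] /=; split=> //; apply/flatten_mapP.
    by exists e => //; rewrite mem_cat /inner_edge Hi mem_head.
  exists e'; first exact: LA.
  by rewrite mem_cat (map_f (Jump e')) ?orbT // mem_filter Hl mem_enum.
case=> /eqP tx _ /flatten_mapP[e' _ /jumps_fromE[[Ex Hi]|[e'' Ex Hl]]].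
  by move: tx; rewrite Ex /= => <-; rewrite mem_cat /inner_edge Hi mem_head.
move: tx; rewrite Ex /= => Ee; rewrite Ee in Hl *.
rewrite mem_cat (map_f (fun e0 => Jump e0 e)) ?orbT // mem_filter Hl.
by rewrite mem_enum.
Qed.

Lemma sync_out_derives e q s : Jderives (label S) q (Core e :: s) ->
  Jderives (label S) (sync_out e q) (Sync e :: s ++ jumps_from inner L e).
Proof.
move=> D; apply: (JD_tensJ D) => //; last exact: nonJ_core.
by apply: JD_Jax => // k /jumps_fromE[[->]|[? ->]].
Qed.

Lemma sync_in_derives e q s A U :
  Jderives (label S) q (Sync e :: s ++ pending A U) ->
  uniq A -> e \in A -> e \notin U -> (forall f, (f, e) \in L -> f \in A) ->
  Jderives (label S) (sync_in e q) (Out e :: s ++ pending A (e :: U)).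
Proof.
move=> D uA eA eU LA; apply: JD_parJ => //.
apply: JD_exchange (permEl (perm_catCA [:: Jcontr e] [:: Sync e] _)).
apply: JD_Jctr => //; last by move=> k /jumps_toE[[->]|[? ->]].
apply: JD_exchange D _.
rewrite /= -[X in perm_eq X]cat_cons -[_ :: s ++ pending A (e :: U)]cat_cons.
rewrite perm_sym perm_catCA perm_cat2l perm_sym.
exact: pending_close.
Qed.

(** An inner edge has its source as target, and a jump obeys the constraint. Contrapositively, no
    J^perp edge leads from a gadget opened outside [p] to one closed inside [p] or right below
    it. *)
Lemma target_back e b p x : constrained L p -> {subset b :: used p <= created p} ->
  (forall f, (f, b) \in L -> f \in created p) ->
  x \in jumps_from inner L e -> target x \in b :: used p -> e \in created p.
Proof.
move=> Cp sub Lb /jumps_fromE[[-> _]|[e' -> Hl]] /=; first exact: sub.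
by rewrite inE => /predU1P[Ee|]; [rewrite Ee in Hl; exact: Lb|exact: constrained_used Hl].
Qed.

(** The sequent must record the uncontracted J^perp edges as well, since closing a gadget further
    down consumes them. *)
Lemma expand_derives p s : derives (label R) p s ->
  {subset deseq p <= links R} -> uniq (created p) -> uniq (used p) ->
  constrained L p ->
  Jderives (label S) (expand p) ([seq Sync e | e <- s] ++ pending (created p) (used p)).
Proof.
have [tS _ _ _] := JL_proof_structure inner L HR.
(* The side conditions of the J-rules are read off the typing of [S]. *)
have tR l : l \in links R -> mllJ_typed (label S) (Jlink l).
  by move=> lR; apply: tS; rewrite mem_cat map_f.
elim=> {p s}.
- move=> a b _ sub _ _ _ /=.
  have [nJ Hd] := tR _ (sub _ (mem_head _ _)).
  rewrite /pending /created /= cats0 filter_predT.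
  have D := sync_out_derives (JD_ax nJ Hd).
  have {}D := JD_exchange D (permEl (perm_catCA [:: Sync a] [:: Core b] _)).
  apply: JD_exchange (sync_out_derives D) _.
  by rewrite /= (perm_catCA [:: Sync b] [:: Sync a]).
- move=> a b c p q s t Dp IHp Dq IHq Hc sub uc uu C.
  have lR := sub _ (mem_head _ _).
  have subp : {subset deseq p <= links R}.
    by move=> x xp; apply: sub; rewrite inE mem_cat xp orbT.
  have subq : {subset deseq q <= links R}.
    by move=> x xp; apply: sub; rewrite inE mem_cat xp !orbT.
  have Cp : constrained L p by apply: constrained_sub C; apply/Sub_tens_l/Sub_refl.
  have Cq : constrained L q by apply: constrained_sub C; apply/Sub_tens_r/Sub_refl.
  have Ca f : (f, a) \in L -> f \in created p.
    by apply: (C (PTens a b c p q)); [exact: Sub_refl|left].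
  have Cb f : (f, b) \in L -> f \in created q.
    by apply: (C (PTens a b c p q)); [exact: Sub_refl|right].
  have sp : {subset a :: used p <= created p}.
    move=> x xp; apply: (derives_created Dp); move: xp.
    by rewrite !(inE, mem_cat) => /orP[]->; rewrite ?orbT.
  have sq : {subset b :: used q <= created q}.
    move=> x xp; apply: (derives_created Dq); move: xp.
    by rewrite !(inE, mem_cat) => /orP[]->; rewrite ?orbT.
  move: uc uu; rewrite created_tens used_tens /=.
  rewrite inE !mem_cat !cat_uniq => /and4P[/norP[cp cq] ucp dj ucq].
  case/and3P=> /norP[_ /norP[ap _]] /norP[_ bnp] /and3P[uup _ uuq].
  have {IHp}Dp' := sync_in_derives (s := map (@Sync E) s) (IHp subp ucp uup Cp) ucp (sp _ (mem_head _ _)) ap Ca.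
  have {IHq}Dq' := sync_in_derives (s := map (@Sync E) t) (IHq subq ucq uuq Cq) ucq (sq _ (mem_head _ _)) bnp Cb.
  have /= [nJa [nJb|//] Ht] := tR _ lR.
  have D := sync_out_derives (JD_tens (c := Core c) Dp' Dq' nJa nJb Ht).
  apply: JD_exchange D _.
  set U := [:: a, b & used p ++ used q].
  have UE x : (x \in U) = (x \in a :: used p) || (x \in b :: used q).
    by rewrite /U !(inE, mem_cat) -!orbA; congr (_ || _); rewrite orbCA.
  (* A jump from [created p] into a gadget closed on the side of [q] would put its source in
     [created q], which is disjoint from [created p]. *)
  have Ep : pending (created p) (a :: used p) = pending (created p) U.
    apply: eq_pending => e x ep xe; rewrite UE orbC.
    case: (boolP (_ \in b :: used q)) => // tx.
    case/hasP: dj; exists e => //; exact: target_back tx.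
  have Eq : pending (created q) (b :: used q) = pending (created q) U.
    apply: eq_pending => e x eq xe; rewrite UE.
    case: (boolP (_ \in a :: used p)) => // tx.
    case/hasP: dj; exists e => //; exact: target_back tx.
  (* No edge leaving the new gadget of [c] has a closed target, otherwise [c] would already be
     created in a premise. *)
  rewrite pending_cons => [|x xc]; last first.
    rewrite UE; apply/norP; split.
      by apply: contraNN cp; exact: target_back xc.
    by apply: contraNN cq; exact: target_back xc.
  rewrite pending_cat -Ep -Eq /= map_cat perm_cons.
  apply: perm_trans (perm_cat (permEl (perm_catACA _ _ _ _)) (perm_refl _)) _.
  by rewrite -catA perm_cat2l perm_catC.
- move=> a b c p s Dp IHp Hc sub uc uu C.
  have lR := sub _ (mem_head _ _).
  have subp : {subset deseq p <= links R}.
    by move=> x xp; apply: sub; rewrite inE xp orbT.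
  have Cp : constrained L p by apply: constrained_sub C; apply/Sub_par/Sub_refl.
  have Ca f : (f, a) \in L -> f \in created p.
    by apply: (C (PPar a b c p)); [exact: Sub_refl|split=> //; left].
  have Cb f : (f, b) \in L -> f \in created p.
    by apply: (C (PPar a b c p)); [exact: Sub_refl|split=> //; right].
  have sp : {subset [:: a, b & used p] <= created p}.
    move=> x xp; apply: (derives_created Dp); move: xp.
    by rewrite !(inE, mem_cat) => /or3P[]->; rewrite ?orbT.
  move: uc uu; rewrite /created /used /= -/(created p) -/(used p).
  case/andP=> cp ucp; rewrite inE => /and3P[/norP[ab ap] bp uup].
  have aA : a \in created p by apply: sp; rewrite mem_head.
  have bA : b \in created p by apply: sp; rewrite !inE eqxx orbT.
  (* Both gadgets are closed above the par rule, [a] first, while [Sync b] waits in the context. *)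
  have Da := sync_in_derives (s := map (@Sync E) (b :: s)) (IHp subp ucp uup Cp) ucp aA ap Ca.
  have {}Da := JD_exchange Da (permEl (perm_catCA [:: Out a] [:: Sync b] _)).
  have bU : b \notin a :: used p by rewrite inE eq_sym negb_or ab.
  have Db := sync_in_derives (s := Out a :: map (@Sync E) s) Da ucp bA bU Cb.
  have {}Db := JD_exchange Db (permEl (perm_catCA [:: Out b] [:: Out a] _)).
  have /= [nJa [nJb|//] Ht] := tR _ lR.
  have D := sync_out_derives (JD_par (c := Core c) Db nJa nJb Ht).
  apply: JD_exchange D _.
  have -> : pending (created p) [:: b, a & used p] = pending (created p) [:: a, b & used p].
    by apply: eq_pending => e x _ _; rewrite !inE orbCA.
  rewrite pending_cons => [|x xc].
    by rewrite /= perm_cons -catA perm_cat2l perm_catC.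
  apply: contraNN cp; rewrite inE => /predU1P[tx|].
    apply: (target_back (b := a)) xc _ => //; last by rewrite tx mem_head.
    by move=> y ya; apply: sp; move: ya; rewrite !inE => /orP[]->; rewrite ?orbT.
  apply: (target_back (b := b)) xc => //.
  by move=> y ya; apply: sp; move: ya; rewrite !inE => /orP[]->; rewrite ?orbT.
- move=> p s t _ IH st sub uc uu C; apply: JD_exchange (IH sub uc uu C) _.
  by rewrite perm_cat2r perm_map.
Qed.

(** At the root all gadgets are open, so any of them may be closed. The passive context [w] is
    general because [foldr] closes the tail first, with [Sync e] waiting in [w]. *)
Lemma sync_in_all_derives q s w U A :
  Jderives (label S) q ([seq Sync e | e <- s] ++ w ++ pending A U) ->
  uniq A -> (forall e, e \in A) -> uniq (s ++ U) ->
  Jderives (label S) (foldr sync_in q s)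
    ([seq Out e | e <- s] ++ w ++ pending A (s ++ U)).
Proof.
move=> + uA AT; elim: s w => //= e s IH w D /andP[es us].
have {}D := JD_exchange D (permEl (perm_catCA [:: Sync e] _ _)).
have {IH}D := IH (Sync e :: w) D us.
rewrite catA -cat_cons; apply: sync_in_derives => //; apply: JD_exchange D _.
by rewrite -catA (perm_catCA _ [:: Sync e]).
Qed.

(** * The links of the expanded proof *)

Local Notation out_links e :=
  [:: LJax (Jaxiom e) (jumps_from inner L e); LTens (Core e) (Jaxiom e) (Sync e)].
Local Notation in_links e :=
  [:: LJctr (jumps_to inner L e) (Jcontr e); LPar (Sync e) (Jcontr e) (Out e)].

Lemma Jdeseq_expand p : perm_eq (Jdeseq (expand p))
  ([seq Jlink l | l <- deseq p] ++
   flatten [seq out_links e | e <- created p] ++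
   flatten [seq in_links e | e <- used p]).
Proof.
(* Counting the links that satisfy an arbitrary predicate reduces the permutation to linear
   arithmetic. *)
elim: p => [a b|a b c p IHp q IHq|a b c p IHp]; apply/permP=> P.
- by rewrite /=; lia.
- move/permP/(_ P): IHp; move/permP/(_ P): IHq.
  rewrite created_tens used_tens /= !(map_cat, flatten_cat, count_cat) /=.
  by rewrite !count_cat /= !count_cat /=; lia.
- move/permP/(_ P): IHp.
  by rewrite /created /used /= !count_cat /= !count_cat /=; lia.
Qed.

Lemma Jdeseq_sync_in_all q s : perm_eq (Jdeseq (foldr sync_in q s))
  (flatten [seq in_links e | e <- s] ++ Jdeseq q).
Proof.
elim: s => //= e s /permP IH; apply/permP=> P /=.
by rewrite (IH P) addnCA.
Qed.

Lemma erase_sync_in_all q s :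
  erase (@origin E) (foldr sync_in q s) = erase (@origin E) q.
Proof. by elim: s. Qed.

Lemma Jseqs_expand p : seqs_constrained L R p ->
  exists2 q, Jseqs S q & erase (@origin E) q = Some p.
Proof.
have [_ Hc Hu Hv] := HR.
case=> -[D pl] Ap.
have pc : perm_eq (created p) (edges R) by apply/perm_flatten/perm_map.
have pu : perm_eq (used p) (used_edges R) by apply/perm_flatten/perm_map.
have uc : uniq (created p) by rewrite (perm_uniq pc).
have uu : uniq (used p) by rewrite (perm_uniq pu).
(* Each element of [E] is created exactly once and, by [uE], is either used exactly once or a
   conclusion. *)
have cE : perm_eq (created p) (enum E).
  by apply: uniq_perm => //; [exact: enum_uniq|move=> x; rewrite (perm_mem pc) Hc mem_enum].
have uE : perm_eq (ps_conclusions R ++ used p) (enum E).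
  apply: uniq_perm; [|exact: enum_uniq|move=> x]; last first.
    rewrite mem_enum mem_cat mem_filter (perm_mem pu) Hc andbT.
    by case: (_ \in _).
  rewrite cat_uniq filter_uniq //= uu andbT; apply/hasPn => x.
  by rewrite mem_filter (perm_mem pu) => ->.
have Cp := above_constrained uu Ap.
have sub : {subset deseq p <= links R} by move=> l; rewrite (perm_mem pl).
have AT e : e \in created p by rewrite (perm_mem cE) mem_enum.
(* The gadgets of the conclusions remain open in [expand p] and are closed at the root. *)
exists (foldr sync_in (expand p) (ps_conclusions R)); last first.
  by rewrite erase_sync_in_all erase_expand.
split.
  have := sync_in_all_derives (w := [::]) (expand_derives D sub uc uu Cp) uc AT.
  rewrite (perm_uniq uE) enum_uniq => /(_ isT) DQ.
  apply: JD_exchange DQ _; rewrite perm_sym.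
  apply: perm_trans (ps_conclusions_JL inner L HR) _.
  (* No J^perp edge is left, as every target is used or a conclusion. *)
  rewrite /= [pending _ _](_ : _ = [::]) ?cats0 //.
  apply/eqP; rewrite -(negbK (_ == _)) -has_filter; apply/hasPn => x _.
  by rewrite negbK (perm_mem uE) mem_enum.
apply: perm_trans (Jdeseq_sync_in_all _ _) _.
apply/permP=> P; rewrite count_cat (permP (Jdeseq_expand p)) !count_cat.
rewrite (permP (perm_map _ pl)).
(* Opening halves are indexed by created occurrences, closing halves by used ones and conclusions;
   both range over [E] and pair up into the gadgets. *)
have /permP/(_ P) := perm_flatten (perm_map (fun e => out_links e) cE).
have /permP/(_ P) := perm_flatten (perm_map (fun e => in_links e) uE).
rewrite map_cat flatten_cat count_cat /= => H1 H2.
rewrite addnC -!addnA; congr (_ + _); rewrite H2 [X in _ + X]addnC H1.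
by elim: (enum E) => //= e s <-; lia.
Qed.

End Expand.

Theorem theorem3p9 (At : Type) (E : finType) (inner : bool)
    (R : pstruct At E) (HR : mll_proof_structure R) (L : {set E * E}) :
  forall p : proof E,
    (exists2 q : Jproof (Jedge E),
       Jseqs (JL inner L R) q & erase (@origin E) q = Some p) <->
    seqs_constrained L R p.
Proof.
move=> p; split=> [[q]|]; first exact: Jseqs_erase.
exact: Jseqs_expand.
Qed.
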